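(* Let $f\in L^\infty(0,\infty;L^2(\Omega)^2)$ and $u\in L^\infty(0,\infty;H^1(\Omega)^2)$. Then there is a generic constant $C>0$ such that for any time step $\Delta t>0$, any integer $n>0$, and any nudging parameters $\mu_1,\mu_2\ge 0$, the velocity and vorticity solutions $v_h^n$, $w_h^n$ of the backward Euler CDA-VV scheme (defined in the context) satisfy $$\|v_h^{n}\|^2 \le \alpha^{-n}\|v_h^{0}\|^2+\frac{C\,C_P^{2}}{\nu}\left(\nu^{-1}\|f\|^2_{L^{\infty}(0,\infty;H^{-1})}+\mu_1\|u\|^2_{L^{\infty}(0,\infty;L^2)}\right),$$ $$\|w_h^{n}\|^2\le \alpha^{-n}\|w_h^{0}\|^2+\frac{C\,C_P^{2}}{\nu}\left(\nu^{-1}\|f\|^2_{L^{\infty}(0,\infty;L^2)}+\mu_2\|\operatorname{rot}u\|^2_{L^{\infty}(0,\infty;L^2)}\right),$$ where $\alpha=1+\nu C_P^{-2}\Delta t$.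
   Context: **Domain and spaces.** $\Omega\subset\mathbb{R}^2$ is the $2\pi$-periodic box; $\|\cdot\|$ and $(\cdot,\cdot)$ are the $L^2(\Omega)$ norm and inner product. $X=H^1_\#(\Omega)^2$, $W=H^1_\#(\Omega)$, $Q=L^2_\#(\Omega)$ are the spaces of $2\pi$-periodic (in each direction), mean-zero functions that are locally in $H^1$ (vector valued), $H^1$ (scalar), and $L^2$ (scalar), respectively. $C_P$ is a Poincaré constant depending only on $\Omega$: $\|\phi\|\le C_P\|\nabla\phi\|$ for all $\phi\in X$ or $W$. $H^{-1}$ is the dual of $X$ with norm $\|f\|_{-1}=\sup_{0\ne\chi\in X}(f,\chi)/\|\nabla\chi\|$. For a vector field $g=(g_1,g_2)$, $\operatorname{rot}g=\partial_x g_2-\partial_y g_1$; for a scalar $w$ and vector $v=(v_1,v_2)$, $w\times v=w(-v_2,v_1)$. Also $$b^*(u,\omega,\chi)=\tfrac12\big((u\cdot\nabla\omega,\chi)-(u\cdot\nabla\chi,\omega)\big).$$ **Discrete spaces.** $\tau_h$ is a regular conforming triangulation of $\Omega$ of mesh width $h$; $X_h=X\cap P_k(\tau_h)$, $Q_h=Q\cap P_{k-1}(\tau_h)$ are Taylor–Hood or Scott–Vogelius elements satisfying the inf-sup condition, and $W_h=W\cap P_k(\tau_h)$. $V_h=\{v_h\in X_h:(\nabla\cdot v_h,q_h)=0\ \forall q_h\in Q_h\}$. The mesh is sufficiently regular that the inverse inequality $\|\nabla\chi_h\|\le Ch^{-1}\|\chi_h\|$ holds on $X_h$. **Interpolation.**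 $\tau_H$ is another regular conforming (coarse) mesh of width $H$; $I_H$ is a linear coarse-mesh interpolation operator into piecewise polynomials $P_r(\tau_H)$ (applied componentwise to vectors) such that for all $H^1$ functions $\phi$: $\|I_H\phi-\phi\|\le CH\|\nabla\phi\|$ and $\|I_H\phi\|\le C\|\phi\|$. **Reference solution.** $\nu>0$, and $u$ is the velocity of a (periodic) solution of the 2D Navier–Stokes equations $u_t-\nu\Delta u+(u\cdot\nabla)u+\nabla p=f$, $\nabla\cdot u=0$. Write $t^n=n\Delta t$, $u^n=u(t^n)$, $f^n=f(t^n)$ (pointwise-in-time values are assumed meaningful and bounded by the $L^\infty$-in-time norms). **Backward Euler CDA-VV scheme.** Given $v_h^0\in V_h$, $w_h^0\in W_h$, find $(v_h^{n+1},w_h^{n+1},P_h^{n+1})\in X_h\times W_h\times Q_h$ for $n=0,1,2,\dots$ such that for all $(\chi_h,\psi_h,r_h)\in X_h\times W_h\times Q_h$: $$\tfrac1{\Delta t}(v_h^{n+1}-v_h^n,\chi_h)+(w_h^n\times v_h^{n+1},\chi_h)-(P_h^{n+1},\nabla\cdot\chi_h)+\nu(\nabla v_h^{n+1},\nabla\chi_h)+\mu_1(I_H(v_h^{n+1}-u^{n+1}),I_H\chi_h)=(f^{n+1},\chi_h),$$ $$(\nabla\cdot v_h^{n+1},r_h)=0,$$ $$\tfrac1{\Delta t}(w_h^{n+1}-w_h^n,\psi_h)+b^*(v_h^{n+1},w_h^{n+1},\psi_h)+\nu(\nabla w_h^{n+1},\nabla\psi_h)+\mu_2(I_H(w_h^{n+1}-\operatorname{rot}u^{n+1}),I_H\psi_h)=(\operatorname{rot}f^{n+1},\psi_h).$$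 **Constants.** $C$ denotes a generic positive constant independent of $n,\Delta t,h,H,\nu,\mu_1,\mu_2,f,u$ and the initial data. *)

(* Defs.v *)
From HB Require Import structures.
From mathcomp Require Import all_boot all_order all_algebra.
From mathcomp Require Import all_classical all_reals all_analysis.
From mathcomp Require Import ess_sup_inf.
Import Order.TTheory GRing.Theory Num.Theory.
Import numFieldNormedType.Exports.

Set Implicit Arguments.
Unset Strict Implicit.
Unset Printing Implicit Defensive.

Local Open Scope classical_set_scope.
Local Open Scope ring_scope.

(* Elements of L^2 and H^1 are represented by functions; two functions equal
   almost everywhere on the box are not identified, but all norms and forms
   below agree on them. *)
Notation sfield R := ((R * R)%type -> R) (only parsing).
Notation vfield R := ('I_2 -> (R * R)%type -> R) (only parsing).

Definition leb2 (R : realType)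
    : {measure set (measurableTypeR R * measurableTypeR R)%type -> \bar R} :=
  ((@lebesgue_measure R) \x (@lebesgue_measure R))%E.

Definition box (R : realType)
    : set (measurableTypeR R * measurableTypeR R)%type :=
  `[0, 2 * pi]%classic `*` `[0, 2 * pi]%classic.
Arguments box : clear implicits.

Lemma measurable_box (R : realType) : measurable (box R).
Proof. by apply: measurableX; exact: measurable_itv. Qed.

Definition mubox (R : realType)
    : {measure set (measurableTypeR R * measurableTypeR R)%type -> \bar R} :=
  mrestr (leb2 R) (@measurable_box R).

Definition L2 {R : realType} (phi : sfield R) : Prop :=
  phi \in Lfun (mubox R) 2%:E.

Definition L2v {R : realType} (g : vfield R) : Prop := forall i, L2 (g i).

Definition ip {R : realType} (phi psi : sfield R) : R :=
  (\int[mubox R]_x (phi x * psi x))%R.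

Definition vip {R : realType} (g k : vfield R) : R :=
  (\int[mubox R]_x (\sum_(i < 2) g i x * k i x))%R.

Definition nrm {R : realType} (phi : sfield R) : R := Num.sqrt (ip phi phi).

Definition vnrm {R : realType} (g : vfield R) : R := Num.sqrt (vip g g).

Definition dir {R : realType} (i : 'I_2) : R * R :=
  if i == 0 then (1, 0) else (0, 1).

Fixpoint Ck {R : realType} (n : nat) (psi : sfield R) : Prop :=
  continuous psi /\
  if n is m.+1 then
    forall i, (forall x, derivable psi x (dir i)) /\ Ck m ('D_(dir i) psi)
  else True.

Definition test_function {R : realType} (psi : sfield R) : Prop :=
  (forall n, Ck n psi) /\
  exists M : R, forall x, (M < `|x.1|) || (M < `|x.2|) -> psi x = 0.

Definition periodic {R : realType} (phi : sfield R) : Prop :=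
  forall x y, phi (x + 2 * pi, y) = phi (x, y) /\
              phi (x, y + 2 * pi) = phi (x, y).

Definition L2per {R : realType} (phi : sfield R) : Prop :=
  periodic phi /\ L2 phi.

Definition weak_partial {R : realType} (i : 'I_2) (phi g : sfield R) : Prop :=
  L2per g /\
  forall psi, test_function psi ->
    (\int[leb2 R]_x (phi x * 'D_(dir i) psi x))%R =
    - (\int[leb2 R]_x (g x * psi x))%R.

Definition H1per {R : realType} (phi : sfield R) : Prop :=
  L2per phi /\ forall i, exists g, weak_partial i phi g.

Definition H1perv {R : realType} (g : vfield R) : Prop := forall i, H1per (g i).

(* A chosen representative of the weak derivative (unique a.e.); 0 when there
   is none. *)
Definition wd {R : realType} (i : 'I_2) (phi : sfield R) : sfield R :=
  xget (cst 0) [set g | weak_partial i phi g].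

Definition mean_zero {R : realType} (phi : sfield R) : Prop :=
  (\int[mubox R]_x phi x)%R = 0.

Definition spQ {R : realType} (q : sfield R) : Prop := L2per q /\ mean_zero q.

Definition spW {R : realType} (w : sfield R) : Prop := H1per w /\ mean_zero w.

Definition spX {R : realType} (v : vfield R) : Prop := forall i, spW (v i).

Definition grad {R : realType} (phi : sfield R) : vfield R :=
  fun i => wd i phi.

Definition vgip {R : realType} (v k : vfield R) : R :=
  (\int[mubox R]_x
     (\sum_(i < 2) \sum_(j < 2) wd j (v i) x * wd j (k i) x))%R.

Definition vgnrm {R : realType} (v : vfield R) : R := Num.sqrt (vgip v v).

Definition div {R : realType} (v : vfield R) : sfield R :=
  fun x => \sum_(i < 2) wd i (v i) x.

Definition rot2 {R : realType} (g : vfield R) : sfield R :=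
  fun x => wd 0 (g 1) x - wd 1 (g 0) x.

(* (rot g, psi) for g merely in L^2: the distribution rot g applied to psi. *)
Definition rot_pair {R : realType} (g : vfield R) (psi : sfield R) : R :=
  (\int[mubox R]_x (g 0 x * wd 1 psi x - g 1 x * wd 0 psi x))%R.

Definition wcross {R : realType} (w : sfield R) (v : vfield R) : vfield R :=
  fun i x => if i == 0 then - (w x * v 1 x) else w x * v 0 x.

Definition advect {R : realType} (u : vfield R) (w : sfield R) : sfield R :=
  fun x => \sum_(i < 2) u i x * wd i w x.

Definition bstar {R : realType} (u : vfield R) (w chi : sfield R) : R :=
  2^-1 * (ip (advect u w) chi - ip (advect u chi) w).

Definition Hm1nrm {R : realType} (g : vfield R) : R :=
  sup [set a | exists chi, [/\ spX chi, 0 < vnrm chi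
                             & a = vip g chi / vgnrm chi]].

Definition poincare {R : realType} (CP : R) : Prop :=
  [/\ 0 < CP,
      forall phi : sfield R, spW phi -> nrm phi <= CP * vnrm (grad phi)
    & forall phi : vfield R, spX phi -> vnrm phi <= CP * vgnrm phi].

(* A triangle is given by its three vertices, a mesh by its set of triangles. *)
Notation triangle R := ('I_3 -> (R * R)%type) (only parsing).

Definition bary {R : realType} (T : triangle R) (l : 'I_3 -> R) : R * R :=
  (\sum_(i < 3) l i * (T i).1, \sum_(i < 3) l i * (T i).2).

(* The convex hull of the vertices of T with index in S; it is empty for
   S = set0, so that conformity below includes the disjoint case. *)
Definition face {R : realType} (T : triangle R) (S : set 'I_3)
    : set (R * R)%type :=
  [set x | exists l : 'I_3 -> R,
     [/\ forall i, 0 <= l i, forall i, ~ S i -> l i = 0,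
         \sum_(i < 3) l i = 1 & x = bary T l]].

Definition cell {R : realType} (T : triangle R) := face T setT.

Definition open_cell {R : realType} (T : triangle R) : set (R * R)%type :=
  [set x | exists l : 'I_3 -> R,
     [/\ forall i, 0 < l i, \sum_(i < 3) l i = 1 & x = bary T l]].

Definition nondegenerate_triangle {R : realType} (T : triangle R) : Prop :=
  ((T 1).1 - (T 0).1) * ((T 2).2 - (T 0).2) -
  ((T 2).1 - (T 0).1) * ((T 1).2 - (T 0).2) != 0.

Definition edist {R : realType} (x y : R * R) : R :=
  Num.sqrt ((x.1 - y.1) ^+ 2 + (x.2 - y.2) ^+ 2).

Definition diam {R : realType} (T : triangle R) : R :=
  sup [set a | exists i j, a = edist (T i) (T j)].

Definition mesh_width {R : realType} (tau : set (triangle R)) : R :=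
  sup [set diam T | T in tau].

Definition conforming_triangulation {R : realType} (tau : set (triangle R))
    : Prop :=
  [/\ finite_set tau, forall T, tau T -> nondegenerate_triangle T,
      \bigcup_(T in tau) cell T = (box R : set (R * R)%type)
    & forall T T', tau T -> tau T' ->
        cell T `&` cell T' = face T [set i | exists j, T i = T' j]].

(* Shape regularity: each triangle T contains a disk of diameter
   diam T / sigma. *)
Definition shape_regular {R : realType} (sigma : R) (tau : set (triangle R))
    : Prop :=
  forall T, tau T -> exists c, forall x,
    edist x c <= diam T / (2 * sigma) -> cell T x.

Definition regular_mesh {R : realType} (sigma : R) (tau : set (triangle R)) :=
  conforming_triangulation tau /\ shape_regular sigma tau.

Definition poly2 {R : realType} (k : nat) (p : sfield R) : Prop :=
  exists c : nat -> nat -> R, forall x,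
    p x = \sum_(i < k.+1) \sum_(j < k.+1 | (i + j <= k)%N)
            c i j * x.1 ^+ i * x.2 ^+ j.

(* P_k(tau): no constraint on edges (a null set) or across them. *)
Definition Pk {R : realType} (k : nat) (tau : set (triangle R))
    (phi : sfield R) : Prop :=
  forall T, tau T -> exists p, poly2 k p /\ {in open_cell T, phi =1 p}.

(* The two velocity-pressure pairs differ only in that the Taylor-Hood
   pressure is continuous. *)
Variant element := TaylorHood | ScottVogelius.

Definition spXh {R : realType} (k : nat) (tau : set (triangle R))
    (v : vfield R) : Prop := spX v /\ forall i, Pk k tau (v i).

Definition spWh {R : realType} (k : nat) (tau : set (triangle R))
    (w : sfield R) : Prop := spW w /\ Pk k tau w.

Definition spQh {R : realType} (el : element) (k : nat)
    (tau : set (triangle R)) (q : sfield R) : Prop :=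
  [/\ spQ q, Pk k.-1 tau q & if el is TaylorHood then continuous q else True].

Definition spVh {R : realType} (el : element) (k : nat)
    (tau : set (triangle R)) (v : vfield R) : Prop :=
  spXh k tau v /\ forall q, spQh el k tau q -> ip (div v) q = 0.

Definition inf_sup {R : realType} (beta : R) (el : element) (k : nat)
    (tau : set (triangle R)) : Prop :=
  forall q, spQh el k tau q ->
    beta * nrm q <=
    sup [set a | exists chi, [/\ spXh k tau chi, 0 < vnrm chi
                               & a = ip q (div chi) / vgnrm chi]].

Definition inverse_inequality {R : realType} (Cinv : R) (k : nat)
    (tau : set (triangle R)) : Prop :=
  forall chi, spXh k tau chi ->
    vgnrm chi <= Cinv * (mesh_width tau)^-1 * vnrm chi.

(* The scheme applies I_H to rot u^n, which is only in L^2, whereas the two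
   estimates are assumed on H^1; the last clause says that I_H on L^2 is the
   extension by density of I_H on H^1. *)
Definition coarse_interpolation {R : realType} (CI : R) (r : nat)
    (tauH : set (triangle R)) (IH : sfield R -> sfield R) : Prop :=
  [/\ forall phi, L2per phi -> L2per (IH phi) /\ Pk r tauH (IH phi),
      forall (a : R) phi psi, L2per phi -> L2per psi ->
        \forall x \ae mubox R,
          IH (fun y => a * phi y + psi y) x = a * IH phi x + IH psi x,
      forall phi, H1per phi ->
        nrm (fun x => IH phi x - phi x) <=
        CI * mesh_width tauH * vnrm (grad phi),
      forall phi, H1per phi -> nrm (IH phi) <= CI * nrm phi
    & forall phi (e : R), L2per phi -> 0 < e ->
        exists psi, [/\ H1per psi, nrm (fun x => psi x - phi x) < e
                      & nrm (fun x => IH psi x - IH phi x) < e]].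

Definition IHv {R : realType} (IH : sfield R -> sfield R) (v : vfield R)
    : vfield R := fun i => IH (v i).

Definition mutime (R : realType)
    : {measure set (measurableTypeR R) -> \bar R} :=
  mrestr (@lebesgue_measure R)
    (measurable_itv `]0, +oo[ : measurable (`]0, +oo[%classic : set R)).

Definition Linf_time {R : realType} (N : R -> R) : \bar R :=
  ess_sup (mutime R) (fun t => (N t)%:E).

Definition joint_measurable {R : realType} (phi : R -> sfield R) : Prop :=
  measurable_fun
    [set z : (measurableTypeR R *
              (measurableTypeR R * measurableTypeR R))%type | 0 < z.1]
    (fun z => phi z.1 z.2).

Definition H1nrm {R : realType} (u : vfield R) : R :=
  Num.sqrt (vnrm u ^+ 2 + vgnrm u ^+ 2).

Definition Linf_L2 {R : realType} (f : R -> vfield R) : Prop :=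
  [/\ forall i, joint_measurable (fun t => f t i),
      \forall t \ae mutime R, L2v (f t)
    & (Linf_time (fun t => vnrm (f t)) < +oo)%E].

Definition Linf_H1 {R : realType} (u : R -> vfield R) : Prop :=
  [/\ forall i, joint_measurable (fun t => u t i),
      \forall t \ae mutime R, H1perv (u t)
    & (Linf_time (fun t => H1nrm (u t)) < +oo)%E].

Definition time_test {R : realType} (theta : R -> R) : Prop :=
  (forall n t, derivable (derive1n n theta) t 1) /\
  exists a b, 0 < a /\ forall t, (t < a) || (b < t) -> theta t = 0.

(* Weak solutions: the equation is tested with theta(t) psi(x), theta in
   C_c^infty(0, oo) and psi a periodic H^1 vector field. *)
Definition NSE_velocity {R : realType} (nu : R) (f u : R -> vfield R) : Prop :=
  (\forall t \ae mutime R, \forall x \ae mubox R, div (u t) x = 0) /\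
  exists p : R -> sfield R,
    [/\ joint_measurable p,
        \forall t \ae mutime R, L2per (p t),
        forall a b : R, 0 < a ->
          (@lebesgue_measure R).-integrable `[a, b]
            (fun t => (nrm (p t))%:E)
      & forall theta psi, time_test theta -> H1perv psi ->
          (\int[mutime R]_t
             (- derive1 theta t * vip (u t) psi +
              theta t * (nu * vgip (u t) psi
                         + vip (fun i => advect (u t) (u t i)) psi
                         - ip (p t) (div psi)
                         - vip (f t) psi)))%R = 0].

(* Elements of L^infty(0, oo) carry no values at given times, so the scheme
   needs those at t^1, t^2, ... to be meaningful and controlled by the norms. *)
Definition pointwise_values {R : realType} (dt : R) (f u : R -> vfield R)
    : Prop :=
  forall n, let t := n.+1%:R * dt in
    [/\ L2v (f t) /\ H1perv (u t),
        ((vnrm (f t))%:E <= Linf_time (fun s => vnrm (f s)))%E,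
        ((Hm1nrm (f t))%:E <= Linf_time (fun s => Hm1nrm (f s)))%E,
        ((vnrm (u t))%:E <= Linf_time (fun s => vnrm (u s)))%E
      & ((nrm (rot2 (u t)))%:E <= Linf_time (fun s => nrm (rot2 (u s))))%E].

Definition CDA_VV {R : realType} (el : element) (k : nat)
    (tauh : set (triangle R)) (IH : sfield R -> sfield R)
    (nu mu1 mu2 dt : R) (f u : R -> vfield R)
    (v : nat -> vfield R) (w P : nat -> sfield R) : Prop :=
  spVh el k tauh (v 0%N) /\ spWh k tauh (w 0%N) /\
  forall n, let t := n.+1%:R * dt in
    (spXh k tauh (v n.+1) /\ spWh k tauh (w n.+1) /\
     spQh el k tauh (P n.+1)) /\
    [/\ forall chi, spXh k tauh chi ->
          dt^-1 * vip (fun i x => v n.+1 i x - v n i x) chi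
          + vip (wcross (w n) (v n.+1)) chi
          - ip (P n.+1) (div chi)
          + nu * vgip (v n.+1) chi
          + mu1 * vip (IHv IH (fun i x => v n.+1 i x - u t i x)) (IHv IH chi)
          = vip (f t) chi,
        forall q, spQh el k tauh q -> ip (div (v n.+1)) q = 0
      & forall psi, spWh k tauh psi ->
          dt^-1 * ip (fun x => w n.+1 x - w n x) psi
          + bstar (v n.+1) (w n.+1) psi
          + nu * vip (grad (w n.+1)) (grad psi)
          + mu2 * ip (IH (fun x => w n.+1 x - rot2 (u t) x)) (IH psi)
          = rot_pair (f t) psi].

(* Main.v *)
(* Energy argument: test the momentum equation with v^{n+1} and the vorticity
   equation with w^{n+1}. The rotational term, the pressure term and b^* then
   vanish, the nudging term is at least -mu/2 |I_H u|^2, half of the dissipation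
   absorbs the forcing, and by Poincare the other half gives
   alpha |v^{n+1}|^2 <= |v^n|^2 + dt (|f|^2/nu + mu C |u|^2); a geometric
   recursion concludes. The representatives chosen by [wd] enter only through
   the norms they define, so uniqueness of weak derivatives is not needed. *)
Require Import Defs.
From HB Require Import structures.
From mathcomp Require Import all_boot all_order all_algebra.
From mathcomp Require Import all_classical all_reals all_analysis.
From mathcomp Require Import ess_sup_inf ring lra.
Import Order.TTheory GRing.Theory Num.Theory.
Import numFieldNormedType.Exports.

Set Implicit Arguments.
Unset Strict Implicit.
Unset Printing Implicit Defensive.

Local Open Scope classical_set_scope.
Local Open Scope ring_scope.

(** * Elementary real inequalities *)

(** For A > 0, evaluate at the minimiser -B / A. The case A = 0 also has to be covered, since [ip]
    is only semidefinite on functions: there a positive B would make the affine function negative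
    somewhere. *)
Lemma discriminant_bound (R : rcfType) (A B C : R) : 0 <= A -> 0 <= C ->
  (forall t, 0 <= t ^+ 2 * A + 2 * t * B + C) -> B <= Num.sqrt A * Num.sqrt C.
Proof.
move=> A0 C0 H; rewrite -sqrtrM//.
have [B0|B0] := ltP 0 B; last by rewrite (le_trans B0)// sqrtr_ge0.
rewrite -[leLHS](gtr0_norm B0) -sqrtr_sqr ler_sqrt ?mulr_ge0//.
have [A_eq0|An0] := eqVneq A 0.
  (* At this t the affine function takes the value -1. *)
  have := H (- (C + 1) / (2 * B)); rewrite A_eq0.
  have -> : forall t, t ^+ 2 * 0 + 2 * t * B + C = t * (2 * B) + C
    by move=> t; ring.
  rewrite divfK; last by rewrite mulf_neq0// gt_eqF.
  lra.
have Agt0 : 0 < A by rewrite lt_neqAle eq_sym An0.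
have := H (- B / A).
have -> : (- B / A) ^+ 2 * A + 2 * (- B / A) * B + C = (A * C - B ^+ 2) / A.
  by field.
by rewrite pmulr_lge0 ?invr_gt0// subr_ge0.
Qed.

Lemma young (R : realFieldType) (a x y : R) : 0 < a ->
  x * y <= a / 2 * y ^+ 2 + a^-1 * x ^+ 2 / 2.
Proof.
move=> a0; rewrite -subr_ge0.
have -> : a / 2 * y ^+ 2 + a^-1 * x ^+ 2 / 2 - x * y =
          (a * y - x) ^+ 2 / (2 * a) by field; rewrite gt_eqF.
by rewrite divr_ge0 ?sqr_ge0// mulr_ge0// ltW.
Qed.

Lemma sqrt_sqrD_ge (R : rcfType) (x y : R) : 0 <= x ->
  x <= Num.sqrt (x ^+ 2 + y ^+ 2).
Proof.
move=> x0; rewrite -[leLHS]ger0_norm// -sqrtr_sqr ler_wsqrtr//.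
by rewrite lerDl sqr_ge0.
Qed.

(** * Finite sums under the integral *)

Section Rintegral_sum.
Context d (T : measurableType d) (R : realType).
Variables (mu : {measure set T -> \bar R}) (I : finType) (h : I -> T -> R).
Hypothesis hint : forall i, mu.-integrable setT (EFin \o h i).

Lemma integrable_EFin_sum :
  mu.-integrable setT (EFin \o (fun x => \sum_i h i x)).
Proof.
have := integrable_sum measurableT (index_enum I) (P := xpredT)
  (fun i _ => hint i).
by apply: eq_integrable => // x _; rewrite /= sumEFin.
Qed.

Lemma Rintegral_sum : \int[mu]_x (\sum_i h i x) = \sum_i \int[mu]_x h i x.
Proof.
rewrite /Rintegral; under eq_integral do rewrite -sumEFin.
rewrite integral_sum// sum_fine// => i _.
exact: (integrable_fin_num measurableT (hint i)).
Qed.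

End Rintegral_sum.

(** * Inner products and norms of square-integrable functions *)

Section L2_forms.
Context {R : realType}.
Implicit Types f g k : (R * R)%type -> R.

Lemma L2_comb (a : R) f g : L2 f -> L2 g -> L2 (fun x => a * f x + g x).
Proof.
move=> Lf Lg; rewrite /L2.
exact: ((@Lfun_submod_closed _ _ R (mubox R) 2%:E (lee1n 2)).2 a f g Lf Lg).
Qed.

Lemma L2_opp f : L2 f -> L2 (fun x => - f x).
Proof.
move=> Lf; have -> : (fun x => - f x) = (fun x => -2 * f x + f x).
  by apply/funext => x; ring.
exact: L2_comb.
Qed.

Lemma L2_integrable f g : L2 f -> L2 g ->
  (mubox R).-integrable setT (EFin \o (fun x => f x * g x)).
Proof. by move=> Lf Lg; apply/Lfun1_integrable; exact: Lfun2_mul_Lfun1. Qed.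

Lemma ipC f g : ip f g = ip g f.
Proof. by apply: eq_Rintegral => x _; rewrite mulrC. Qed.

Lemma ip_ge0 f : 0 <= ip f f.
Proof. by apply: Rintegral_ge0 => x _; rewrite -expr2 sqr_ge0. Qed.

Lemma ip_combl (a : R) f g k : L2 f -> L2 g -> L2 k ->
  ip (fun x => a * f x + g x) k = a * ip f k + ip g k.
Proof.
move=> Lf Lg Lk; rewrite /ip -RintegralZl//; last exact: L2_integrable.
rewrite -RintegralD//; last 2 first.
(* Adding the zero function brings [a * f] into the form handled by [L2_comb]. *)
- have -> : EFin \o (fun x => a * (f x * k x)) =
    (EFin \o (fun x => (a * f x + cst 0 x) * k x)).
    by apply/funext => x /=; rewrite addr0 mulrA.
  apply: L2_integrable => //; apply: L2_comb => //.
  exact: (@Lfun_submod_closed _ _ R (mubox R) 2%:E (lee1n 2)).1.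
- exact: L2_integrable.
by apply: eq_Rintegral => x _; rewrite mulrDl mulrA.
Qed.

(** Serves to use the linearity of [IH], which holds only almost everywhere. *)
Lemma ae_eq_ipl f g k : L2 f -> L2 g -> L2 k ->
  (\forall x \ae mubox R, f x = g x) -> ip f k = ip g k.
Proof.
move=> Lf Lg Lk fg; congr fine; apply: ae_eq_integral => //.
- by have /integrableP[] := L2_integrable Lf Lk.
- by have /integrableP[] := L2_integrable Lg Lk.
- have := ae_filter_ringOfSetsType (mubox R) => ?.
  by apply: filterS fg => x -> _.
Qed.

Lemma nrm_ge0 f : 0 <= nrm f. Proof. exact: sqrtr_ge0. Qed.

Lemma nrm_sqr f : nrm f ^+ 2 = ip f f.
Proof. by rewrite sqr_sqrtr// ip_ge0. Qed.

Section families.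
Context {I : finType}.
Implicit Types F G K : I -> (R * R)%type -> R.

(** A finite index set lets one argument serve scalars (['I_1]) and planar vector fields
    (['I_2]). *)
Definition sip F G : R := \sum_i ip (F i) (G i).

Lemma sipC F G : sip F G = sip G F.
Proof. by apply: eq_bigr => i _; rewrite ipC. Qed.

Lemma sip_ge0 F : 0 <= sip F F.
Proof. by apply: sumr_ge0 => i _; exact: ip_ge0. Qed.

Lemma sip_combl (a : R) F G K : (forall i, L2 (F i)) -> (forall i, L2 (G i)) ->
  (forall i, L2 (K i)) ->
  sip (fun i x => a * F i x + G i x) K = a * sip F K + sip G K.
Proof.
move=> LF LG LK; rewrite /sip mulr_sumr -big_split.
by apply: eq_bigr => i _; rewrite ip_combl.
Qed.

(** Expansion of the square of a F + G. Arbitrary a gives Cauchy-Schwarz through the discriminant; a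
    = -1 gives the polarization bound. *)
Lemma sip_quadratic (a : R) F G :
  (forall i, L2 (F i)) -> (forall i, L2 (G i)) ->
  0 <= a ^+ 2 * sip F F + 2 * a * sip F G + sip G G.
Proof.
move=> LF LG; pose H := fun i x => a * F i x + G i x.
have LH i : L2 (H i) by exact: L2_comb.
have := sip_ge0 H; rewrite sip_combl// [sip F H]sipC [sip G H]sipC !sip_combl//.
by rewrite [sip G F]sipC; congr (_ <= _); ring.
Qed.

Lemma sip_cauchy_schwarz F G :
  (forall i, L2 (F i)) -> (forall i, L2 (G i)) ->
  sip F G <= Num.sqrt (sip F F) * Num.sqrt (sip G G).
Proof.
move=> LF LG; apply: discriminant_bound; rewrite ?sip_ge0// => t.
exact: sip_quadratic.
Qed.

(** By polarization the right side is half of |F|^2 - |G|^2 + |F - G|^2, and the last square is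
    dropped. Both the time difference and the nudging term are bounded below in this way. *)
Lemma sip_subl_ge F G : (forall i, L2 (F i)) -> (forall i, L2 (G i)) ->
  (sip F F - sip G G) / 2 <= sip (fun i x => F i x - G i x) F.
Proof.
move=> LF LG; have := sip_quadratic (-1) LG LF.
have -> : (fun i x => F i x - G i x) = (fun i x => -1 * G i x + F i x).
  by apply/funext => i; apply/funext => x; ring.
rewrite sip_combl//; lra.
Qed.

End families.

Lemma ip_sip f g : ip f g = sip (fun _ : 'I_1 => f) (fun _ : 'I_1 => g).
Proof. by rewrite /sip big_ord1. Qed.

Lemma ip_subl_ge f g : L2 f -> L2 g ->
  (nrm f ^+ 2 - nrm g ^+ 2) / 2 <= ip (fun x => f x - g x) f.
Proof. by move=> Lf Lg; rewrite !nrm_sqr !ip_sip; exact: sip_subl_ge. Qed.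

Lemma ip_cauchy_schwarz f g : L2 f -> L2 g -> ip f g <= nrm f * nrm g.
Proof. by move=> Lf Lg; rewrite /nrm !ip_sip; exact: sip_cauchy_schwarz. Qed.

Lemma nrm_distC f g : nrm (fun x => f x - g x) = nrm (fun x => g x - f x).
Proof.
by rewrite /nrm; congr Num.sqrt; apply: eq_Rintegral => x _; ring.
Qed.

(** Apply Cauchy-Schwarz to both terms of (f, f) = (g, f) + (f - g, f), then divide by |f|. *)
Lemma ler_nrm_dist f g : L2 f -> L2 g ->
  nrm f <= nrm g + nrm (fun x => f x - g x).
Proof.
move=> Lf Lg; set h := fun x => f x - g x.
have hE : h = (fun x => -1 * g x + f x) by apply/funext => x; rewrite /h; ring.
have Lh : L2 h by rewrite hE; exact: L2_comb.
have fE : f = (fun x => 1 * g x + h x) by apply/funext => x; rewrite /h; ring.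
have [f0|fn0] := eqVneq (nrm f) 0; first by rewrite f0 addr_ge0// nrm_ge0.
have fgt0 : 0 < nrm f by rewrite lt_neqAle eq_sym fn0 nrm_ge0.
rewrite -(ler_pM2l fgt0) -expr2 nrm_sqr {1}fE ip_combl// mul1r mulrDr.
by rewrite lerD// mulrC ip_cauchy_schwarz.
Qed.

Lemma ler_nrmB f g : L2 f -> L2 g ->
  nrm (fun x => f x - g x) <= nrm f + nrm g.
Proof.
move=> Lf Lg; set h := fun x => f x - g x.
have hE : h = (fun x => -1 * g x + f x) by apply/funext => x; rewrite /h; ring.
have Lh : L2 h by rewrite hE; exact: L2_comb.
(* Here h is compared with f, and the remainder h - f is -g. *)
have := ler_nrm_dist Lh Lf; congr (_ <= _ + _); congr Num.sqrt.
by apply: eq_Rintegral => x _; rewrite /h; ring.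
Qed.

Lemma vipE (g k : 'I_2 -> (R * R)%type -> R) : L2v g -> L2v k ->
  vip g k = sip g k.
Proof. by move=> Lg Lk; apply: Rintegral_sum => i; exact: L2_integrable. Qed.

End L2_forms.

(** * Vector fields, weak gradients and the dual norm *)

Section vector_forms.
Context {R : realType}.
Implicit Types (phi : (R * R)%type -> R) (g k v : 'I_2 -> (R * R)%type -> R).

Lemma vip_ge0 g : 0 <= vip g g.
Proof.
by apply: Rintegral_ge0 => x _; apply: sumr_ge0 => i _; rewrite -expr2 sqr_ge0.
Qed.

Lemma vgip_ge0 v : 0 <= vgip v v.
Proof.
apply: Rintegral_ge0 => x _; apply: sumr_ge0 => i _; apply: sumr_ge0 => j _.
by rewrite -expr2 sqr_ge0.
Qed.

Lemma vnrm_ge0 g : 0 <= vnrm g. Proof. exact: sqrtr_ge0. Qed.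

Lemma vgnrm_ge0 v : 0 <= vgnrm v. Proof. exact: sqrtr_ge0. Qed.

Lemma vnrm_sqr g : vnrm g ^+ 2 = vip g g.
Proof. by rewrite sqr_sqrtr// vip_ge0. Qed.

Lemma vgnrm_sqr v : vgnrm v ^+ 2 = vgip v v.
Proof. by rewrite sqr_sqrtr// vgip_ge0. Qed.

Lemma vip_cauchy_schwarz g k : L2v g -> L2v k -> vip g k <= vnrm g * vnrm k.
Proof. by move=> Lg Lk; rewrite /vnrm !vipE//; exact: sip_cauchy_schwarz. Qed.

Lemma vip_subl_ge g k : L2v g -> L2v k ->
  (vnrm g ^+ 2 - vnrm k ^+ 2) / 2 <= vip (fun i x => g i x - k i x) g.
Proof.
move=> Lg Lk; rewrite !vnrm_sqr !vipE//; first exact: sip_subl_ge.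
move=> i; have -> : (fun x => g i x - k i x) = (fun x => -1 * k i x + g i x).
  by apply/funext => x; ring.
exact: L2_comb.
Qed.

Lemma vnrm_sqrE g : L2v g -> vnrm g ^+ 2 = \sum_(i < 2) nrm (g i) ^+ 2.
Proof.
by move=> Lg; rewrite vnrm_sqr vipE//; apply: eq_bigr => i _; rewrite nrm_sqr.
Qed.

Lemma H1per_L2 phi : H1per phi -> L2 phi.
Proof. by move=> [[]]. Qed.

Lemma wd_L2per i phi : H1per phi -> L2per (wd i phi).
Proof.
move=> [_ /(_ i) [g gP]]; rewrite /wd.
by have [] := xgetPex (cst 0) (ex_intro [set h | weak_partial i phi h] g gP).
Qed.

Lemma grad_L2v phi : H1per phi -> L2v (grad phi).
Proof. by move=> H i; have [] := wd_L2per i H. Qed.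

Lemma L2per_comb (a : R) phi psi : L2per phi -> L2per psi ->
  L2per (fun x => a * phi x + psi x).
Proof.
move=> [pphi Lphi] [ppsi Lpsi]; split; last exact: L2_comb.
move=> x y; have [h1 h2] := pphi x y; have [h3 h4] := ppsi x y.
by rewrite h1 h2 h3 h4.
Qed.

Lemma rot2_L2per v : H1perv v -> L2per (rot2 v).
Proof.
move=> Hv; rewrite /rot2.
have -> : (fun x => wd 0 (v 1) x - wd 1 (v 0) x) =
          (fun x => -1 * wd 1 (v 0) x + wd 0 (v 1) x).
  by apply/funext => x; rewrite mulN1r addrC.
exact: L2per_comb (wd_L2per 1 (Hv 0))
                  (wd_L2per 0 (Hv 1)).
Qed.

Lemma vgnrm_sqrE v : H1perv v ->
  vgnrm v ^+ 2 = \sum_(i < 2) vnrm (grad (v i)) ^+ 2.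
Proof.
move=> Hv; rewrite vgnrm_sqr; under eq_bigr do rewrite vnrm_sqr.
apply: Rintegral_sum => i; apply: integrable_EFin_sum => j.
by apply: L2_integrable; exact: grad_L2v.
Qed.

Lemma nrm_wd_le v i j : H1perv v -> nrm (wd j (v i)) <= vgnrm v.
Proof.
move=> Hv; rewrite -(@ler_pXn2r _ 2) ?nnegrE ?nrm_ge0 ?vgnrm_ge0//.
rewrite (vgnrm_sqrE Hv); apply: (@le_trans _ _ (vnrm (grad (v i)) ^+ 2)).
  rewrite (vnrm_sqrE (grad_L2v (Hv i))) (bigD1 j)//= lerDl.
  by apply: sumr_ge0 => ? _; exact: sqr_ge0.
by rewrite (bigD1 i)//= lerDl; apply: sumr_ge0 => ? _; exact: sqr_ge0.
Qed.

(** The crude factor 2 is harmless: the bound only serves to show that the time norm of the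
    vorticity is finite. *)
Lemma nrm_rot2_le v : H1perv v -> nrm (rot2 v) <= 2 * vgnrm v.
Proof.
move=> Hv; apply: le_trans (ler_nrmB (wd_L2per 0 (Hv 1)).2
                                     (wd_L2per 1 (Hv 0)).2) _.
by rewrite mulrDl !mul1r lerD// nrm_wd_le.
Qed.

(** The pairing is the inner product of g with the rotated gradient (d_y phi, -d_x phi), which has
    the same norm as the gradient. *)
Lemma rot_pair_le g phi : L2v g -> H1per phi ->
  rot_pair g phi <= vnrm g * vnrm (grad phi).
Proof.
move=> Lg Hphi; pose k i x := if i == 0 :> 'I_2 then wd 1 phi x
                              else - wd 0 phi x.
have Lk : L2v k.
  move=> i; rewrite /k; case: (i == 0); last apply: L2_opp.
    exact: (wd_L2per 1 Hphi).2.
  exact: (wd_L2per 0 Hphi).2.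
have lift1 : lift ord0 ord0 = 1 :> 'I_2 by exact/val_inj.
have lift0 : ord0 = 0 :> 'I_2 by exact/val_inj.
have -> : rot_pair g phi = vip g k.
  apply: eq_Rintegral => x _.
  by rewrite !big_ord_recl big_ord0 lift1 lift0 /k /= mulrN addr0.
have -> : vnrm (grad phi) = vnrm k.
  congr Num.sqrt; apply: eq_Rintegral => x _.
  rewrite /grad /k !big_ord_recl !big_ord0 lift1 lift0 /=.
  by move: (wd 0 phi x) (wd 1 phi x) => a b; rewrite mulrNN !addr0 addrC.
exact: vip_cauchy_schwarz.
Qed.

Lemma poincare_vgnrm_gt0 (CP : R) v : poincare CP -> spX v -> 0 < vnrm v ->
  0 < vgnrm v.
Proof.
move=> [CP0 _ P] Xv v0; have := lt_le_trans v0 (P v Xv).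
by rewrite pmulr_rgt0.
Qed.

Lemma spX_L2v v : spX v -> L2v v.
Proof. by move=> Xv i; have [H _] := Xv i; exact: H1per_L2. Qed.

(** Bounds the set whose supremum is [Hm1nrm], so that this real supremum really dominates each
    quotient. *)
Lemma dual_quotient_le (CP : R) g v : poincare CP -> L2v g -> spX v ->
  0 < vnrm v -> vip g v / vgnrm v <= CP * vnrm g.
Proof.
move=> P Lg Xv v0; have vg0 := poincare_vgnrm_gt0 P Xv v0.
rewrite ler_pdivrMr// (le_trans (vip_cauchy_schwarz Lg (spX_L2v Xv)))//.
rewrite mulrAC [leRHS]mulrC ler_wpM2l ?vnrm_ge0//; by case: P => _ _; exact.
Qed.

Lemma Hm1nrm_le (CP : R) g : poincare CP -> L2v g -> Hm1nrm g <= CP * vnrm g.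
Proof.
move=> P Lg; rewrite /Hm1nrm; set A := [set _ | _].
have ubA : ubound A (CP * vnrm g).
  by move=> _ [v [Xv v0 ->]]; exact: dual_quotient_le.
(* The supremum of the empty set is 0 by convention. *)
have [->|A0] := eqVneq A set0; last exact/ge_sup/ubA/set0P.
by rewrite sup0 mulr_ge0 ?vnrm_ge0//; case: P => /ltW.
Qed.

(* The case [vnrm v = 0] is apart because its vanishing does not make
   [vgnrm v], which depends on chosen representatives, vanish by definition. *)
Lemma vip_dual_young (CP L a : R) g v : poincare CP -> L2v g -> spX v ->
  0 < a -> Hm1nrm g <= L ->
  vip g v <= a / 2 * vgnrm v ^+ 2 + a^-1 * L ^+ 2 / 2.
Proof.
move=> P Lg Xv a0 gL.
have [v0|v0] := ltP 0 (vnrm v); last first.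
  have v_eq0 : vnrm v = 0 by apply/eqP; rewrite eq_le v0 vnrm_ge0.
  have := vip_cauchy_schwarz Lg (spX_L2v Xv); rewrite v_eq0 mulr0 => h.
  apply: le_trans h _; apply: addr_ge0.
    by rewrite mulr_ge0 ?sqr_ge0// divr_ge0// ltW.
  by rewrite divr_ge0// mulr_ge0 ?sqr_ge0// invr_ge0 ltW.
have vg0 := poincare_vgnrm_gt0 P Xv v0.
have : vip g v / vgnrm v <= Hm1nrm g.
  apply: ub_le_sup; last by exists v.
  by exists (CP * vnrm g) => _ [x [Xx x0 ->]]; exact: dual_quotient_le.
move=> /le_trans/(_ gL); rewrite ler_pdivrMr// => /le_trans; apply.
exact: young.
Qed.

End vector_forms.

(** * From the energy identity to geometric decay *)

Section scalar_recursion.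
Context {R : realType}.

(** K is the fixed point of the recursion with equality, so the excess of [a n] over K shrinks by
    the factor 1 / al at each step. *)
Lemma geometric_bound (al K : R) (a : nat -> R) : 0 < al ->
  (forall n, al * a n.+1 <= a n + (al - 1) * K) ->
  0 <= K -> forall n, a n <= al ^- n * a 0 + K.
Proof.
move=> al0 H K0; elim=> [|n IHn]; first by rewrite expr0 invr1 mul1r lerDl.
rewrite -(ler_pM2l al0) (le_trans (H n))//.
have -> : al * (al ^- n.+1 * a 0 + K) = al ^- n * a 0 + al * K.
  by rewrite exprS invfM mulrDr !mulrA mulfV ?gt_eqF// mul1r.
by rewrite mulrBl mul1r; lra.
Qed.

(* In the energy identity [a n] is the squared norm at time n, [g] the squared
   gradient norm, [d] the time difference, [m] the nudging and [F] the forcing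
   term; the Poincare inequality turns half of the dissipation into [al]. *)
Lemma energy_bound (CP nu dt mu CI L U : R) (a g d m F : nat -> R) :
  0 < CP -> 0 < nu -> 0 < dt -> 0 <= mu ->
  (forall n, a n.+1 <= CP ^+ 2 * g n) ->
  (forall n, (a n.+1 - a n) / 2 <= d n) ->
  (forall n, - ((CI * U) ^+ 2 / 2) <= m n) ->
  (forall n, F n <= nu / 2 * g n + nu^-1 * L ^+ 2 / 2) ->
  (forall n, dt^-1 * d n + nu * g n + mu * m n = F n) ->
  forall n, a n <= (1 + nu * CP ^- 2 * dt) ^- n * a 0
    + (1 + CI ^+ 2) * CP ^+ 2 / nu * (nu^-1 * L ^+ 2 + mu * U ^+ 2).
Proof.
move=> CP0 nu0 dt0 mu0 Hg Hd Hm HF E n.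
set al := 1 + _; set B := nu^-1 * L ^+ 2 + mu * (CI * U) ^+ 2.
have B0 : 0 <= B by rewrite addr_ge0// mulr_ge0// ?sqr_ge0// invr_ge0 ltW.
have c0 : 0 <= CP ^+ 2 / nu by rewrite divr_ge0 ?sqr_ge0// ltW.
have al0 : 0 < al.
  by rewrite ltr_wpDr// mulr_ge0 ?(ltW dt0)// divr_ge0 ?sqr_ge0// ltW.
(* The energy identity is multiplied by 2 dt. Half of the dissipation remains after absorbing the
   forcing, and K = CP^2 / nu * B is chosen so that (al - 1) K = dt B. *)
have step k : al * a k.+1 <= a k + (al - 1) * (CP ^+ 2 / nu * B).
  have -> : (al - 1) * (CP ^+ 2 / nu * B) = dt * B.
    by rewrite /al; field; rewrite !gt_eqF.
  have h1 : nu * CP ^- 2 * dt * a k.+1 <= nu * dt * g k.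
    have -> : nu * dt * g k = nu * CP ^- 2 * dt * (CP ^+ 2 * g k).
      by field; rewrite gt_eqF.
    by rewrite ler_wpM2l// mulr_ge0 ?(ltW dt0)// divr_ge0 ?sqr_ge0// ltW.
  have h2 : d k + nu * dt * g k + dt * mu * m k = dt * F k.
    by rewrite -E; field; rewrite gt_eqF.
  have h3 := ler_wpM2l (ltW dt0) (HF k).
  have h4 := ler_wpM2l (mulr_ge0 (ltW dt0) mu0) (Hm k).
  have h5 := Hd k.
  rewrite /al mulrDl mul1r /B.
  set p := nu^-1 * L ^+ 2 in h3 *; set q := (CI * U) ^+ 2 in h4 *.
  have e3 : dt * (nu / 2 * g k + p / 2) = nu * dt * g k / 2 + dt * p / 2.
    by ring.
  have e4 : dt * mu * - (q / 2) = - (dt * mu * q / 2) by ring.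
  have e5 : dt * (p + mu * q) = dt * p + dt * mu * q by ring.
  rewrite e3 in h3; rewrite e4 in h4; rewrite e5; lra.
have /(_ n) := geometric_bound al0 step (mulr_ge0 c0 B0).
(* The forcing carries the factor 1 and the nudging CI^2; the common factor 1 + CI^2 dominates
   both. *)
move=> /le_trans; apply; rewrite lerD2l.
have -> : (1 + CI ^+ 2) * CP ^+ 2 / nu * (nu^-1 * L ^+ 2 + mu * U ^+ 2) =
  CP ^+ 2 / nu * ((1 + CI ^+ 2) * (nu^-1 * L ^+ 2 + mu * U ^+ 2)) by ring.
rewrite ler_wpM2l// /B exprMn.
have h1 : 0 <= nu^-1 * L ^+ 2 by rewrite mulr_ge0 ?sqr_ge0// invr_ge0 ltW.
have h2 : 0 <= mu * U ^+ 2 by rewrite mulr_ge0 ?sqr_ge0.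
have -> : nu^-1 * L ^+ 2 + mu * (CI ^+ 2 * U ^+ 2) =
  nu^-1 * L ^+ 2 + CI ^+ 2 * (mu * U ^+ 2) by ring.
have := mulr_ge0 (sqr_ge0 CI) h1.
move: (nu^-1 * L ^+ 2) (mu * U ^+ 2) h1 h2 => s t; rewrite mulrDl mul1r mulrDr.
lra.
Qed.

End scalar_recursion.

(** * Essential suprema in time *)

Section time_norm.
Context {R : realType}.
Implicit Types N M : R -> R.

(** [fine] sends an infinite value to 0, so each time norm in the final bounds must be shown finite
    by comparison with the given norms of f and u. *)
Lemma Linf_time_lty (c : R) N M : 0 <= c ->
  (\forall t \ae mutime R, N t <= c * M t) ->
  (Linf_time M < +oo)%E -> (Linf_time N < +oo)%E.
Proof.
move=> c0 NM /ess_supr_bounded[B MB].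
have := ae_filter_ringOfSetsType (mutime R) => ?.
apply: (@le_lt_trans _ _ (c * B)%:E); last exact: ltry.
apply/ess_supP; apply: filterS2 NM MB => t Nt Mt.
by rewrite lee_fin (le_trans Nt)// ler_wpM2l.
Qed.

Lemma le_fine_Linf_time (x : R) N : (x%:E <= Linf_time N)%E ->
  (Linf_time N < +oo)%E -> x <= fine (Linf_time N).
Proof.
(* The real lower bound x excludes the value -oo. *)
move=> xN Ny; rewrite -lee_fin fineK// fin_numElt Ny andbT.
by rewrite (lt_le_trans _ xN)// ltNyr.
Qed.

End time_norm.

(** * Stability of the interpolation and the nudging terms *)

Section interpolation.
Context {R : realType} (CI : R) (r : nat) (tauH : set ('I_3 -> (R * R)%type)).
Context (IH : ((R * R)%type -> R) -> ((R * R)%type -> R)).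
Hypotheses (CI0 : 0 < CI) (HIH : coarse_interpolation CI r tauH IH).
Implicit Types phi psi : (R * R)%type -> R.

Lemma interp_L2 phi : L2per phi -> L2 (IH phi).
Proof. by case: HIH => + _ _ _ _ => /[apply] -[[]]. Qed.

(* The H^1 bound extends to L^2 by density. *)
Lemma nrm_interp_le phi : L2per phi -> nrm (IH phi) <= CI * nrm phi.
Proof.
move=> Lphi; apply/ler_addgt0Pr => e e0.
(* With d = e / (CI + 1), the two approximation errors add up to CI d + d = e. *)
have [_ _ _ H1bound /(_ phi (e / (CI + 1)) Lphi)[|]] := HIH.
  by rewrite divr_gt0// addr_gt0.
move=> psi [Hpsi psi_phi Ipsi_phi].
have h1 := ler_nrm_dist (interp_L2 Lphi) (interp_L2 Hpsi.1).
have h2 := ler_nrm_dist (H1per_L2 Hpsi) Lphi.2.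
have h3 := H1bound _ Hpsi; have h4 := ler_wpM2l (ltW CI0) h2.
have h5 := ler_wpM2l (ltW CI0) (ltW psi_phi).
rewrite nrm_distC in h1.
have -> : e = CI * (e / (CI + 1)) + e / (CI + 1).
  by field; rewrite gt_eqF// addr_gt0.
rewrite mulrDr in h4; lra.
Qed.

(** Linearity turns the pairing into (I phi - I psi, I phi), which polarization bounds below by (|I
    phi|^2 - |I psi|^2) / 2. The first square is dropped and the second is bounded by the L^2
    stability of [IH]. *)
Lemma nudging_ge phi psi : L2per phi -> L2per psi ->
  - ((CI * nrm psi) ^+ 2 / 2) <= ip (IH (fun x => phi x - psi x)) (IH phi).
Proof.
move=> Lphi Lpsi; have [_ lin _ _ _] := HIH.
have -> : (fun x => phi x - psi x) = (fun x => -1 * psi x + phi x).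
  by apply/funext => x; ring.
have LI := interp_L2 Lphi; have LJ := interp_L2 Lpsi.
have LK := interp_L2 (L2per_comb (-1) Lpsi Lphi).
rewrite (ae_eq_ipl LK (L2_comb (-1) LJ LI) LI (lin _ _ _ Lpsi Lphi)).
have -> : (fun x => -1 * IH psi x + IH phi x) = (fun x => IH phi x - IH psi x).
  by apply/funext => x; ring.
apply: le_trans (ip_subl_ge LI LJ).
have : nrm (IH psi) ^+ 2 <= (CI * nrm psi) ^+ 2.
  by rewrite lerXn2r ?nnegrE ?nrm_ge0 ?mulr_ge0 ?nrm_ge0 ?(ltW CI0)//
    nrm_interp_le.
have := sqr_ge0 (nrm (IH phi)); lra.
Qed.

Lemma vnudging_ge (v u : 'I_2 -> (R * R)%type -> R) :
  (forall i, L2per (v i)) -> (forall i, L2per (u i)) ->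
  - ((CI * vnrm u) ^+ 2 / 2) <=
    vip (IHv IH (fun i x => v i x - u i x)) (IHv IH v).
Proof.
move=> Lv Lu; rewrite vipE; last 2 first.
- move=> i; apply: interp_L2.
  have -> : (fun x => v i x - u i x) = (fun x => -1 * u i x + v i x).
    by apply/funext => x; ring.
  exact: L2per_comb.
- by move=> i; exact: interp_L2.
have -> : - ((CI * vnrm u) ^+ 2 / 2) =
    \sum_(i < 2) - ((CI * nrm (u i)) ^+ 2 / 2).
  rewrite exprMn (vnrm_sqrE (fun i => (Lu i).2)) mulr_sumr mulr_suml -sumrN.
  by apply: eq_bigr => i _; rewrite exprMn.
by apply: ler_sum => i _; exact: nudging_ge.
Qed.

End interpolation.

(** * Terms that vanish when the solution is its own test function *)

Section cancellations.
Context {R : realType}.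

Lemma vip_wcross (w : (R * R)%type -> R) (v : 'I_2 -> (R * R)%type -> R) :
  vip (wcross w v) v = 0.
Proof.
(* Zero is written as the integral of 0, so that the pointwise orthogonality of [wcross w v] and v
   suffices. *)
have := Rintegral_cst (mubox R) measurableT 0; rewrite mul0r => <-.
apply: eq_Rintegral => x _; rewrite !big_ord_recl big_ord0 /wcross /=.
have -> : lift ord0 ord0 = 1 :> 'I_2 by exact/val_inj.
have -> : ord0 = 0 :> 'I_2 by exact/val_inj.
by move: (v 0 x) (v 1 x) (w x) => a b c; ring.
Qed.

Lemma bstar_diag (v : 'I_2 -> (R * R)%type -> R) (w : (R * R)%type -> R) :
  bstar v w w = 0.
Proof. by rewrite /bstar subrr mulr0. Qed.

End cancellations.

(** * Energy estimates for velocity and vorticity *)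

Theorem lemma3p4 (R : realType) (el : element) (k r : nat)
    (sigma beta Cinv CI : R) :
  (0 < k)%N -> 0 < sigma -> 0 < beta -> 0 < Cinv -> 0 < CI ->
  exists C : R, 0 < C /\
  forall (CP : R) (tauh tauH : set ('I_3 -> (R * R)%type))
    (IH : ((R * R)%type -> R) -> ((R * R)%type -> R)),
  poincare CP ->
  regular_mesh sigma tauh -> inf_sup beta el k tauh ->
  inverse_inequality Cinv k tauh ->
  regular_mesh sigma tauH -> coarse_interpolation CI r tauH IH ->
  forall (nu : R) (f u : R -> 'I_2 -> (R * R)%type -> R),
  0 < nu -> Linf_L2 f -> Linf_H1 u -> NSE_velocity nu f u ->
  forall dt mu1 mu2 : R,
  0 < dt -> 0 <= mu1 -> 0 <= mu2 -> pointwise_values dt f u ->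
  forall (v : nat -> 'I_2 -> (R * R)%type -> R)
    (w P : nat -> (R * R)%type -> R),
  CDA_VV el k tauh IH nu mu1 mu2 dt f u v w P ->
  forall n : nat, (0 < n)%N ->
  let alpha := 1 + nu * CP ^- 2 * dt in
  vnrm (v n) ^+ 2 <=
    alpha ^- n * vnrm (v 0%N) ^+ 2
    + C * CP ^+ 2 / nu *
      (nu^-1 * fine (Linf_time (fun t => Hm1nrm (f t))) ^+ 2
       + mu1 * fine (Linf_time (fun t => vnrm (u t))) ^+ 2)
  /\
  nrm (w n) ^+ 2 <=
    alpha ^- n * nrm (w 0%N) ^+ 2
    + C * CP ^+ 2 / nu *
      (nu^-1 * fine (Linf_time (fun t => vnrm (f t))) ^+ 2
       + mu2 * fine (Linf_time (fun t => nrm (rot2 (u t)))) ^+ 2).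
Proof.
move=> _ _ _ _ CI0; exists (1 + CI ^+ 2); split.
  by rewrite ltr_pwDl// sqr_ge0.
move=> CP tauh tauH IH P _ _ _ _ HIH nu f u nu0 [_ fL2 fy] [_ uH1 uy] _.
move=> dt mu1 mu2 dt0 mu10 mu20 pt v w Pr [[[Xv0 _] _] [[Ww0 _] scheme]] n _.
move=> al; have [CP0 Ps Pv] := P.
(* Time 0 is covered by the initial data, later times by the scheme. *)
have Xv j : spX (v j) by case: j => // j; have [[[]]] := scheme j.
have Ww j : spW (w j) by case: j => // j; have [[_ [[]]]] := scheme j.
have Lv j : L2v (v j) by exact: spX_L2v.
have Hw j : H1per (w j) := (Ww j).1.
have Hu j : H1perv (u (j.+1%:R * dt)) by have [[]] := pt j.
have Lf j : L2v (f (j.+1%:R * dt)) by have [[]] := pt j.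
have aeF := ae_filter_ringOfSetsType (mutime R).
have Hm1y : (Linf_time (fun t => Hm1nrm (f t)) < +oo)%E.
  apply: Linf_time_lty (ltW CP0) _ fy.
  by apply: filterS fL2 => t; exact: Hm1nrm_le.
have vuy : (Linf_time (fun t => vnrm (u t)) < +oo)%E.
  apply: Linf_time_lty ler01 _ uy; apply: nearW => t.
  by rewrite mul1r sqrt_sqrD_ge// vnrm_ge0.
have roty : (Linf_time (fun t => nrm (rot2 (u t))) < +oo)%E.
  apply: Linf_time_lty (ler0n R 2) _ uy; apply: filterS uH1 => t Ht.
  rewrite (le_trans (nrm_rot2_le Ht))// ler_pM2l//.
  by rewrite /H1nrm addrC sqrt_sqrD_ge// vgnrm_ge0.
have sq_poincare (x y : R) : 0 <= x -> 0 <= y -> x <= CP * y ->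
    x ^+ 2 <= CP ^+ 2 * y ^+ 2.
  move=> x0 y0 xy; rewrite -exprMn lerXn2r// nnegrE// mulr_ge0// ltW//.
(* Passes from the norm of the reference data at one time to its norm in time. *)
have sq_le (x y : R) : 0 <= x -> x <= y ->
    - ((CI * y) ^+ 2 / 2) <= - ((CI * x) ^+ 2 / 2).
  move=> x0 xy; rewrite lerN2 ler_pM2r ?invr_gt0// lerXn2r ?nnegrE//.
  - by rewrite mulr_ge0// ltW.
  - by rewrite mulr_ge0 ?(ltW CI0)// (le_trans x0).
  - by rewrite ler_pM2l.
split.
(* Only [a] is indexed by its own time level; entry j of the other sequences belongs to the step
   from j to j + 1. *)
- apply: (energy_bound (a := fun j => vnrm (v j) ^+ 2)
    (g := fun j => vgnrm (v j.+1) ^+ 2)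
    (d := fun j => vip (fun i x => v j.+1 i x - v j i x) (v j.+1))
    (m := fun j => vip (IHv IH (fun i x => v j.+1 i x - u (j.+1%:R * dt) i x))
                       (IHv IH (v j.+1)))
    (F := fun j => vip (f (j.+1%:R * dt)) (v j.+1))) => // j.
  + by apply: sq_poincare; rewrite ?vnrm_ge0 ?vgnrm_ge0//; exact: Pv.
  + exact: vip_subl_ge.
  + have [_ _ _ uk _] := pt j.
    apply: le_trans (sq_le _ _ (vnrm_ge0 _) (le_fine_Linf_time uk vuy)) _.
    apply: (vnudging_ge CI0 HIH) => i; last exact: (Hu j i).1.
    exact: (Xv j.+1 i).1.1.
  + have [_ _ fk _ _] := pt j.
    exact: (vip_dual_young P (Lf j) (Xv j.+1) nu0 (le_fine_Linf_time fk Hm1y)).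
  + have [[Xhv [_ QP]] [mom incomp _]] := scheme j.
    (* The pressure term vanishes because the new pressure is admissible in the discrete
       incompressibility condition. *)
    have := mom _ Xhv; rewrite vip_wcross addr0 ipC (incomp _ QP) subr0.
    by rewrite vgnrm_sqr.
- apply: (energy_bound (a := fun j => nrm (w j) ^+ 2)
    (g := fun j => vnrm (grad (w j.+1)) ^+ 2)
    (d := fun j => ip (fun x => w j.+1 x - w j x) (w j.+1))
    (m := fun j => ip (IH (fun x => w j.+1 x - rot2 (u (j.+1%:R * dt)) x))
                       (IH (w j.+1)))
    (F := fun j => rot_pair (f (j.+1%:R * dt)) (w j.+1))) => // j.
  + by apply: sq_poincare; rewrite ?nrm_ge0 ?vnrm_ge0//; exact: Ps.
  + by apply: ip_subl_ge; exact: H1per_L2.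
  + have [_ _ _ _ uk] := pt j.
    apply: le_trans (sq_le _ _ (nrm_ge0 _) (le_fine_Linf_time uk roty)) _.
    exact: (nudging_ge CI0 HIH (Hw j.+1).1 (rot2_L2per (Hu j))).
  + have [_ fk _ _ _] := pt j.
    set L := fine _; set G := vnrm (grad _).
    have fL : vnrm (f (j.+1%:R * dt)) <= L := le_fine_Linf_time fk fy.
    have G0 : 0 <= G := vnrm_ge0 _.
    (* The derivative in rot f falls on the test function, so the L^2 norm of f suffices and the
       gradient of w is absorbed by Young. *)
    apply: le_trans (rot_pair_le (Lf j) (Hw j.+1)) _.
    apply: le_trans (ler_wpM2r G0 fL) _; exact: young.
  + have [[_ [Whw _]] [_ _ vort]] := scheme j.
    by have := vort _ Whw; rewrite bstar_diag addr0 vnrm_sqr.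
Qed.
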